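(* Let $s>1$ and let $\mathbf{x}:\mathbb{R}\to\mathbb{R}^d$ be the 1-periodic arc-length parametrization of a unit-length, non-self-intersecting $C^4$ closed curve. There exists a constant $C>0$, depending only on $s$ and the curve $\mathbf{x}$, such that the following holds. For any $\epsilon>0$ there exists $N_0$, depending on $\epsilon$, $s$ and the curve $\mathbf{x}$, such that for every $N>N_0$ and every solution $\mathbf{Z}(t)=(z_1(t),\dots,z_N(t))$, $t\ge 0$, of the system $$\dot z_i=-N^{-s}\sum_{1\le j\le N,\ j\ne i}\nabla W(\mathbf{x}(z_i)-\mathbf{x}(z_j))\cdot \mathbf{x}'(z_i),\qquad i=1,\dots,N,$$ with initial data satisfying $z_1(0)<\cdots<z_N(0)<z_1(0)+1$, one has $$E(\mathbf{Z}(t))\le \tilde\zeta(s)\,(1+\epsilon)\qquad\text{for all } t\ge \frac{C}{\epsilon}.$$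
   Context: $W(\mathbf{v})=\frac{|\mathbf{v}|^{-s}}{s}$ for $\mathbf{v}\in\mathbb{R}^d\setminus\{0\}$, so $\nabla W(\mathbf{v})=-|\mathbf{v}|^{-s-2}\mathbf{v}$. The parametrization satisfies $|\mathbf{x}'(z)|=1$ and $\mathbf{x}(z+1)=\mathbf{x}(z)$ for all $z\in\mathbb{R}$, and non-self-intersecting means $\mathbf{x}(y)=\mathbf{x}(z)$ only if $y-z\in\mathbb{Z}$. The energy is $$E(\mathbf{Z})=N^{-s-1}\sum_{1\le i<j\le N}W(\mathbf{x}(z_i)-\mathbf{x}(z_j)).$$ Also $\zeta(s)=\sum_{i=1}^\infty i^{-s}$ and $\tilde\zeta(s)=\zeta(s)/s$. (Because of the singularity of $W$ at $0$, the ordering $z_1<\dots<z_N<z_1+1$ is preserved for all time.) *)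

(* Defs.v *)
From mathcomp Require Import all_boot all_order all_algebra.
From mathcomp Require Import all_classical all_reals all_analysis.

Set Implicit Arguments.
Unset Strict Implicit.
Unset Printing Implicit Defensive.

Import Order.TTheory GRing.Theory Num.Theory.
Import numFieldNormedType.Exports.

Local Open Scope classical_set_scope.
Local Open Scope ring_scope.

Section EuclideanSpace.
Context {R : realType} {d : nat}.
Implicit Types u v : 'rV[R]_d.

Definition dot u v : R := \sum_(k < d) u 0 k * v 0 k.

(* The library norm `|v| on row vectors is the sup norm. *)
Definition enorm v : R := Num.sqrt (dot v v).

Definition grad (f : 'rV[R]_d -> R) v : 'rV[R]_d :=
  \row_(k < d) 'D_(delta_mx 0 k) f v.

End EuclideanSpace.

(* C^n regularity of a curve; the topology on 'rV[R]_d is the usual one. *)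
Definition curve_of_class {R : realType} {d : nat} (n : nat)
    (x : R -> 'rV[R]_d) : Prop :=
  (forall (k : nat) (t : R), (k < n)%N -> derivable (derive1n k x) t 1) /\
  continuous (derive1n n x).

(* Unit speed and period 1, injective on a period: the curve has length 1. *)
Definition arclength_closed_curve {R : realType} {d : nat}
    (x : R -> 'rV[R]_d) : Prop :=
  [/\ (forall t : R, enorm (derive1 x t) = 1),
      (forall t : R, x (t + 1) = x t) &
      (forall t u : R, x t = x u -> exists m : int, t - u = m%:~R)].

Section RieszEnergy.
Context {R : realType} {d : nat}.
Implicit Types (s : R) (x : R -> 'rV[R]_d).

Definition W s (v : 'rV[R]_d) : R := enorm v `^ (- s) / s.

Definition energy s x (N : nat) (Z : 'I_N -> R) : R :=
  N%:R `^ (- s - 1) *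
  \sum_(i < N) \sum_(j < N | (i < j)%N) W s (x (Z i) - x (Z j)).

Definition velocity s x (N : nat) (Z : 'I_N -> R) (i : 'I_N) : R :=
  - N%:R `^ (- s) *
  \sum_(j < N | j != i)
    dot (grad (W s) (x (Z i) - x (Z j))) (derive1 x (Z i)).

(* z solves the system on [0, +oo[: the derivatives are taken relative to
   [0, +oo[, hence one-sided at 0.  Since W is only defined away from 0, a
   solution stays in the set of configurations without collision; without the
   first clause, the total functions above would give a meaningless right-hand
   side at a collision. *)
Definition is_solution s x (N : nat) (z : 'I_N -> R -> R) : Prop :=
  (forall t : R, 0 <= t -> forall i j, i != j -> x (z i t) <> x (z j t)) /\
  (forall t : R, 0 <= t -> forall i,
    (z i u - z i t) / (u - t) @[u --> within [set u : R | 0 <= u] t^']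
      --> velocity s x (fun j => z j t) i).

End RieszEnergy.

Definition ordered_configuration {R : realType} (N : nat) (Z : 'I_N -> R) :
    Prop :=
  (forall i j : 'I_N, (i < j)%N -> Z i < Z j) /\
  (forall i j : 'I_N, i = 0%N :> nat -> j = N.-1 :> nat -> Z j < Z i + 1).

Definition zeta {R : realType} (s : R) : R :=
  limn (fun n => \sum_(1 <= i < n.+1) i%:R `^ (- s)).

Definition zetat {R : realType} (s : R) : R := zeta s / s.

(* Main.v *)
Require Import Defs.
From mathcomp Require Import all_boot all_order all_algebra.
From mathcomp Require Import all_classical all_reals all_analysis.
From mathcomp Require Import ring lra.

Import Order.TTheory GRing.Theory Num.Theory.
Import numFieldNormedType.Exports.

Local Open Scope classical_set_scope.
Local Open Scope ring_scope.

(** The flow is the gradient flow of the energy up to the factor [N]: along a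
    solution the derivative of the energy is minus the mean of the squared
    velocities ([energy_is_derive]). The theorem follows from a coercivity
    estimate: an energy above [zetat s] forces this mean to be large.

    Suppose first that two points interact through the two arcs between them,
    with the energy [r ^ (- s) / s + (1 - r) ^ (- s) / s] for arcs of lengths [r]
    and [1 - r]. The total energy is then a convex function of the positions,
    and its value at the equidistant configuration is a partial sum of the
    series of [zetat s] ([sum_cyclic_distances]). Let [a i] be the displacement of the [i]-th point
    from the equidistant configuration that has the same first point; it is at
    most 1 in absolute value. Convexity gives that the derivative [S] of the
    energy in the direction [a] is at least the energy minus [zetat s], and
    Cauchy-Schwarz gives that the mean squared velocity is at least [S ^ 2].

    On the curve this survives up to errors, pair by pair. Two tangents at arc
    distance [r] have inner product [1 - O(r^2)] ([curve_tangents]), hence for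
    close points the chord has length [r (1 - O(r^2))] and makes an angle with
    cosine [1 - O(r^2)] with both tangents; the convexity inequality for one
    pair then holds up to the factor [1 - O(r)] ([pair_variation_near]). Pairs
    that are not close have bounded interaction, because the curve is compact
    and does not meet itself ([pair_variation_far]); there are at most [N ^ 2]
    of them, and the normalization [N ^ (- s - 1)] makes their contribution
    [O(N ^ (1 - s))]. Summing over pairs ([coercivity]) gives
    [S >= (1 - eta) E - zetat s - C N ^ (1 - s)] for the energy [E], and so
    [S >= (E - zetat s) / 2] when [E >= zetat s (1 + eps)] and [N] is large.

    Thus [f = E - zetat s] satisfies [f' <= - (f / 2) ^ 2] as long as
    [f >= zetat s * eps], which bounds [f] by a multiple of [1 / t] whatever its
    initial value ([quadratic_decay]): the time needed is a multiple of
    [1 / eps]. The order of the points, on which the estimate relies, is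
    preserved because two points that meet on the curve have parameters that
    differ by an integer ([solution_gap]). *)

(** * The Euclidean inner product *)

Section DotTheory.
Context {R : realType} {d : nat}.
Implicit Types u v w : 'rV[R]_d.

Lemma dotC u v : dot u v = dot v u.
Proof. by apply: eq_bigr => k _; rewrite mulrC. Qed.

Lemma dotDl u v w : dot (u + v) w = dot u w + dot v w.
Proof.
by rewrite /dot -big_split; apply: eq_bigr => k _; rewrite mxE mulrDl.
Qed.

Lemma dotZl (a : R) u w : dot (a *: u) w = a * dot u w.
Proof. by rewrite /dot mulr_sumr; apply: eq_bigr => k _; rewrite mxE mulrA. Qed.

Lemma dotNl u w : dot (- u) w = - dot u w.
Proof. by rewrite -scaleN1r dotZl mulN1r. Qed.

Lemma dotBl u v w : dot (u - v) w = dot u w - dot v w.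
Proof. by rewrite dotDl dotNl. Qed.

Lemma dotZr (a : R) u w : dot w (a *: u) = a * dot w u.
Proof. by rewrite !(dotC w) dotZl. Qed.

Lemma dotBr u v w : dot w (u - v) = dot w u - dot w v.
Proof. by rewrite !(dotC w) dotBl. Qed.

Lemma dot_delta u (k : 'I_d) : dot u (delta_mx 0 k) = u 0 k.
Proof.
rewrite /dot (bigD1 k)//= big1 ?addr0 => [|j jk]; rewrite mxE.
  by rewrite !eqxx mulr1.
by rewrite (negbTE jk) andbF mulr0.
Qed.

Lemma dotvv_ge0 v : 0 <= dot v v.
Proof. by apply: sumr_ge0 => k _; rewrite -expr2 sqr_ge0. Qed.

Lemma dotvv_eq0 v : (dot v v == 0) = (v == 0).
Proof.
apply/eqP/eqP => [|->]; last by rewrite -(scale0r 0) dotZl mul0r.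
move=> /eqP; rewrite psumr_eq0 => [|k _]; last by rewrite -expr2 sqr_ge0.
move=> /allP v0; apply/rowP => k; rewrite mxE; apply/eqP.
by have := v0 k (mem_index_enum k); rewrite mulf_eq0 orbb.
Qed.

Lemma dotvv_gt0 v : v != 0 -> 0 < dot v v.
Proof. by move=> v0; rewrite lt_def dotvv_eq0 v0 dotvv_ge0. Qed.

Lemma enorm_ge0 v : 0 <= enorm v. Proof. exact: sqrtr_ge0. Qed.

Lemma enorm0 : enorm (0 : 'rV[R]_d) = 0.
Proof. by apply/eqP; rewrite sqrtr_eq0 le_eqVlt dotvv_eq0 eqxx. Qed.

Lemma enorm_gt0 v : v != 0 -> 0 < enorm v.
Proof. by move=> v0; rewrite sqrtr_gt0 dotvv_gt0. Qed.

Lemma sqr_enorm v : enorm v ^+ 2 = dot v v.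
Proof. by rewrite sqr_sqrtr// dotvv_ge0. Qed.

Lemma enormN v : enorm (- v) = enorm v.
Proof. by rewrite /enorm dotNl dotC dotNl opprK. Qed.

(** Expanding the square of [v - (v . u) u] gives Cauchy-Schwarz against a unit
    vector. *)
Lemma norm_dot_unit u v : enorm u = 1 -> `|dot v u| <= enorm v.
Proof.
move=> u1; rewrite -(@ler_pXn2r _ 2)// ?nnegrE ?enorm_ge0// real_normK ?num_real//.
have uu : dot u u = 1 by rewrite -sqr_enorm u1 expr1n.
rewrite sqr_enorm -subr_ge0; have := dotvv_ge0 (v - dot v u *: u).
rewrite dotBl !dotBr !dotZl !dotZr uu (dotC u v); congr (_ <= _); ring.
Qed.

(** Polarization for unit vectors. *)
Lemma dot_unit u v : enorm u = 1 -> enorm v = 1 ->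
  dot u v = 1 - dot (u - v) (u - v) / 2.
Proof.
move=> u1 v1; have := sqr_enorm u; have := sqr_enorm v.
rewrite u1 v1 expr1n dotBl !dotBr (dotC v u) => <- <-; lra.
Qed.

Lemma enorm_powR v (a : R) : enorm v `^ a = dot v v `^ (a / 2).
Proof. by rewrite /enorm -powR12_sqrt ?dotvv_ge0// -powRrM mulrC. Qed.

End DotTheory.

(** * Power functions and the zeta function *)

Section Powers.
Context {R : realType}.
Implicit Types a b r s : R.

(** With [t = a / b] this says [t^-s >= 1 - s (t - 1)]: writing [t^-s] as
    [exp (- s ln t)], it follows from [exp u >= 1 + u] and [ln t <= t - 1]. *)
Lemma powR_tangent_le s a b : 0 <= s -> 0 < a -> 0 < b ->
  b `^ (- s) * (1 - s * (a / b - 1)) <= a `^ (- s).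
Proof.
move=> s0 a0 b0; have t0 : 0 < a / b by rewrite divr_gt0.
rewrite -{2}(divfK (lt0r_neq0 b0) a) (powRM _ (ltW t0) (ltW b0)).
rewrite [leLHS]mulrC ler_pM2r ?powR_gt0//.
rewrite /powR gt_eqF//; apply: le_trans (expR_ge1Dx _).
rewrite lerD2l mulNr lerN2 ler_wpM2l//.
by have := @le_ln1Dx R (a / b - 1); rewrite [1 + _]addrC subrK; apply; lra.
Qed.

Lemma powR_antitone s a b : 0 <= s -> 0 < a -> a <= b -> b `^ (- s) <= a `^ (- s).
Proof.
move=> s0 a0 ab; have b0 : 0 < b by exact: lt_le_trans ab.
rewrite !powRN lef_pV2 ?posrE ?powR_gt0//.
by rewrite ge0_ler_powR// ?nnegrE ltW.
Qed.

(** For [0 < s - 1] the tangent inequality for the exponent [s - 1] bounds each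
    term by a telescoping difference. *)
Lemma zeta_partial_bounded s n : 1 < s ->
  \sum_(1 <= i < n.+1) i%:R `^ (- s) <= 1 + (s - 1)^-1 :> R.
Proof.
move=> s1; have s0 : 0 < s - 1 by lra.
suff : \sum_(1 <= i < n.+2) i%:R `^ (- s)
         <= 1 + (s - 1)^-1 * (1 - n.+1%:R `^ (1 - s)) :> R.
  rewrite big_nat_recr//= mulrBr mulr1.
  have ? : 0 <= n.+1%:R `^ (- s) :> R by exact: powR_ge0.
  have : 0 <= (s - 1)^-1 * n.+1%:R `^ (1 - s).
    by rewrite mulr_ge0 ?powR_ge0// invr_ge0 ltW.
  lra.
elim: n => [|n IHn]; first by rewrite big_nat1 !powR1 subrr mulr0 addr0.
rewrite big_nat_recr//= (le_trans (lerD IHn (lexx _)))//.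
rewrite -addrA lerD2l -lerBrDl -mulrBr ler_pdivlMl//.
have e : 1 - s = - (s - 1) by ring.
have k0 : 0 < n.+2%:R :> R by rewrite ltr0n.
have := @powR_tangent_le (s - 1) n.+1%:R n.+2%:R (ltW s0) (ltr0Sn _ _) k0.
have -> : n.+2%:R `^ (- s) = n.+2%:R `^ (1 - s) / n.+2%:R :> R.
  rewrite -(powR_inv1 (ltW k0)) -powRD; first by congr (_ `^ _); ring.
  by rewrite lt0r_neq0// implybT.
rewrite e; set p := _ `^ _; set q := _ `^ _ => h.
suff -> : (s - 1) * (p / n.+2%:R) = p * (1 - (s - 1) * (n.+1%:R / n.+2%:R - 1)) - p.
  by rewrite (_ : 1 - p - (1 - q) = q - p) ?lerD2r//; ring.
by rewrite -(natr1 n.+1) in k0 *; field; rewrite lt0r_neq0.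
Qed.

Lemma zeta_partial_le s n : 1 < s ->
  \sum_(1 <= i < n.+1) i%:R `^ (- s) <= zeta s :> R.
Proof.
move=> s1.
have nd : {homo (fun n => \sum_(1 <= i < n.+1) i%:R `^ (- s)) :
    m n / (m <= n)%N >-> (m : R) <= n}.
  apply: homo_leq => // [x y z|k]; first exact: le_trans.
  by rewrite [leRHS]big_nat_recr//= lerDl powR_ge0.
apply: (nondecreasing_cvgn_le nd); apply: nondecreasing_is_cvgn => //.
by exists (1 + (s - 1)^-1) => _ [k _ <-]; exact: zeta_partial_bounded.
Qed.

Lemma zeta_gt0 s : 1 < s -> 0 < zeta s.
Proof.
move=> s1; apply: lt_le_trans (zeta_partial_le s 1 s1).
by rewrite big_nat1 powR1 ltr01.
Qed.

End Powers.

(** * Summation over pairs *)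

Lemma sum_pairs_sym (V : nmodType) (N : nat) (F : 'I_N -> 'I_N -> V) :
  \sum_(i < N) \sum_(j < N | (i < j)%N) (F i j + F j i) =
  \sum_(i < N) \sum_(j < N | j != i) F i j.
Proof.
under eq_bigr do rewrite big_split.
rewrite big_split /= addrC (exchange_big_dep xpredT)//= -big_split /=.
apply: eq_bigr => i _; rewrite [RHS](bigID (fun j : 'I_N => (j < i)%N)) /=.
by congr (_ + _); apply: eq_bigl => j; rewrite -val_eqE /=; case: ltngtP.
Qed.

(** On the discrete circle of [N] points, every point sees the other points at
    the forward distances [1, ..., N - 1]. *)
Lemma sum_cyclic_distances (V : nmodType) (N : nat) (f : nat -> V) :
  \sum_(i < N) \sum_(j < N | (i < j)%N) (f (j - i)%N + f (N - (j - i))%N) =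
  (\sum_(1 <= k < N) f k) *+ N.
Proof.
pose F (i j : 'I_N) := f (if (i < j)%N then (j - i)%N else (N - (i - j))%N).
transitivity (\sum_(i < N) \sum_(j < N | (i < j)%N) (F i j + F j i)).
  apply: eq_bigr => i _; apply: eq_bigr => j ij.
  by rewrite /F ij ltnNge (ltnW ij).
rewrite sum_pairs_sym -[X in _ *+ X](card_ord N) -sumr_const.
rewrite [RHS](eq_bigl xpredT)//; apply: eq_bigr => i _.
rewrite (bigID (fun j : 'I_N => (i < j)%N)) /=.
rewrite (@big_cat_nat _ _ _ (N - i)%N) ?leq_subr ?subn_gt0//=; congr (_ + _).
  transitivity (\sum_(0 <= j < N | (i < j)%N) f (j - i)%N).
    rewrite big_mkord; apply: eq_big => [j|j /andP[_]]; last by rewrite /F => ->.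
    by rewrite -val_eqE /=; case: ltngtP.
  rewrite (@big_cat_nat _ _ _ i.+1)//= big1_seq ?add0r; last first.
    by move=> j /andP[ij]; rewrite mem_index_iota /= ltnS leqNgt ij.
  rewrite big_nat_cond (eq_bigl (fun j => (i < j < N)%N)); last first.
    by move=> j; rewrite andb_idr// => /andP[].
  rewrite -big_nat -add1n big_addn; apply: eq_bigr => j _.
  by rewrite addnK.
transitivity (\sum_(0 <= j < N | (j < i)%N) f (N - (i - j))%N).
  rewrite big_mkord; apply: eq_big => [j|j /andP[_]].
    by rewrite -val_eqE /=; case: ltngtP.
  by rewrite /F => /negbTE ->.
rewrite (@big_cat_nat _ _ _ i)//= 1?ltnW// [X in _ + X]big1_seq ?addr0; last first.
  by move=> j /andP[ji]; rewrite mem_index_iota => /andP[]; rewrite leqNgt ji.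
rewrite big_nat_cond (eq_bigl (fun j => (0 <= j < i)%N)); last first.
  by move=> j; rewrite andb_idr// => /andP[].
rewrite -big_nat -[in RHS](add0n (N - i)%N) big_addn subKn 1?ltnW//.
apply: eq_big_nat => j /andP[_ ji]; congr f.
by rewrite subnBA 1?ltnW// addnBA 1?ltnW// addnC.
Qed.

(** * The force between two points *)

Lemma is_derive1_ext {R : realType} (f g : R -> R) (t df dg : R) :
  is_derive t 1 f df -> (forall p, f p = g p) -> df = dg -> is_derive t 1 g dg.
Proof. by move=> fd /funext <- <-. Qed.

Section Gradient.
Context {R : realType} {d : nat}.
Implicit Types (s t : R) (u v : 'rV[R]_d).

Lemma is_derive_powR_half s (q : R -> R) t dq : s != 0 -> 0 < q t ->
  is_derive t 1 q dq ->
  is_derive t 1 (fun p => q p `^ (- s / 2) / s)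
    (- (q t `^ ((- s - 2) / 2) * (dq / 2))).
Proof.
move=> s0 q0 dq1; have dp := is_derive1_powR (- s / 2) q0.
have dc := is_derive1_comp dp dq1.
apply: is_derive1_ext (is_deriveZ s^-1 dc) _ _ => [p|].
  by rewrite [RHS]mulrC.
rewrite (_ : (- s - 2) / 2 = - s / 2 - 1); last by field.
by rewrite /GRing.scale/=; field.
Qed.

Lemma is_derive_dotl (f : R -> 'rV[R]_d) t (df u : 'rV[R]_d) :
  (forall k, is_derive t 1 (fun p => f p 0 k) (df 0 k)) ->
  is_derive t 1 (fun p => dot (f p) u) (dot df u).
Proof.
move=> fd; rewrite /dot.
have -> : (fun p => \sum_(k < d) f p 0 k * u 0 k) =
          \sum_(k < d) (u 0 k *: (fun p => f p 0 k)).
  by apply/funext => p; rewrite fct_sumE; apply: eq_bigr => k _; rewrite mulrC.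
have -> : \sum_(k < d) df 0 k * u 0 k = \sum_(k < d) (u 0 k *: df 0 k).
  by apply: eq_bigr => k _; rewrite mulrC.
by apply: is_derive_sum => k; apply: is_deriveZ.
Qed.

Lemma is_derive_dotvv (f : R -> 'rV[R]_d) t (df : 'rV[R]_d) :
  (forall k, is_derive t 1 (fun p => f p 0 k) (df 0 k)) ->
  is_derive t 1 (fun p => dot (f p) (f p)) (2 * dot df (f t)).
Proof.
move=> fd; rewrite /dot mulr_sumr.
have -> : (fun p => \sum_(k < d) f p 0 k * f p 0 k) =
          \sum_(k < d) ((fun p => f p 0 k) * (fun p => f p 0 k)).
  by apply/funext => p; rewrite fct_sumE.
apply: is_derive_sum => k.
apply: is_derive_eq (is_deriveM (fd k) (fd k)) _.
by rewrite /GRing.scale/=; ring.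
Qed.

Lemma is_derive_W s (f : R -> 'rV[R]_d) t (df : 'rV[R]_d) : s != 0 -> f t != 0 ->
  (forall k, is_derive t 1 (fun p => f p 0 k) (df 0 k)) ->
  is_derive t 1 (fun p => W s (f p))
    (- (enorm (f t) `^ (- s - 2) * dot (f t) df)).
Proof.
move=> s0 ft0 /is_derive_dotvv fd.
have := is_derive_powR_half _ _ _ _ s0 (dotvv_gt0 _ ft0) fd.
move=> /is_derive1_ext; apply => [p|]; first by rewrite /W enorm_powR.
by rewrite enorm_powR mulrAC divff// mul1r (dotC df).
Qed.

Lemma grad_W s v : s != 0 -> v != 0 ->
  grad (W s) v = - (enorm v `^ (- s - 2)) *: v.
Proof.
move=> s0 v0; apply/rowP => k; rewrite !mxE.
pose f (h : R) : 'rV[R]_d := h *: delta_mx 0 k + v.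
have f0 : f 0 = v by rewrite /f scale0r add0r.
have fd : is_derive (0 : R) 1 (fun h => W s (f h))
    (- (enorm (f 0) `^ (- s - 2) * dot (f 0) (delta_mx 0 k))).
  apply: is_derive_W; rewrite ?f0// => j.
  have -> : (fun h => f h 0 j) = (delta_mx 0 k : 'rV[R]_d) 0 j *: id + cst (v 0 j).
    by apply/funext => h; rewrite /f !mxE mulrC.
  rewrite -[X in is_derive _ _ _ X]addr0; apply: is_deriveD.
  apply: is_derive_eq (is_deriveZ _ (is_derive_id (0 : R) 1)) _.
  by rewrite /GRing.scale/= mulr1.
have := @derive_val _ _ _ _ _ _ _ fd; rewrite f0 dot_delta mulNr => <-.
have e : (fun h : R => h^-1 *: (W s (h *: delta_mx 0 k + v) - W s v)) =
         (fun h => h^-1 *: (W s (f (h *: 1 + 0)) - W s (f 0))).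
  by apply/funext => h; rewrite addr0 f0 /f /GRing.scale/= mulr1.
by rewrite /derive e.
Qed.

Lemma dot_grad_W s v u : s != 0 -> v != 0 ->
  dot (grad (W s) v) u = - (enorm v `^ (- s - 2) * dot v u).
Proof. by move=> s0 v0; rewrite grad_W// dotZl mulNr. Qed.

Lemma W_ge0 s v : 0 < s -> 0 <= W s v.
Proof. by move=> s0; exact: divr_ge0 (powR_ge0 _ _) (ltW s0). Qed.

Lemma WN s v : W s (- v) = W s v.
Proof. by rewrite /W enormN. Qed.

End Gradient.

(** The scalar content of the estimate for two close points: [r] is the arc
    length, [E] the chord length, [al] and [be] are the projections of the chord
    on the two tangents, [G = E^-s] and [P = rho^-s]. *)
Lemma short_chord_estimate {R : realFieldType} (s eta A r E al be a b rho G P : R) :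
  1 < s -> 0 < eta -> eta <= 1 / 2 -> 0 < A -> 0 < r ->
  r * ((1 + 6 * s) * A + 2) <= eta ->
  (1 - A * r ^+ 2) * r <= al -> (1 - A * r ^+ 2) * r <= be ->
  al <= E -> be <= E -> E <= r -> 0 < E ->
  0 < G -> 0 < P -> 0 < rho -> `|b| <= 1 -> a - b = r - rho ->
  G * (1 - s * (rho / E - 1)) <= P ->
  (1 - eta) * (G / s) - P / s <= G / E ^+ 2 * (be * b - al * a).
Proof.
move=> s1 eta0 eta1 A0 r0 rd al1 be1 alE beE Er E0 G0 P0 rho0 /ler_normlP[b1 b2].
move=> ab T; have Ar : 0 < A * r by rewrite mulr_gt0.
have r1 : r <= 1 / 4 by nra.
have Ar1 : (1 + 6 * s) * (A * r) <= eta by nra.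
have Ar2 : A * r <= 1 / 2 by nra.
have kAr : A * r ^+ 2 <= A * r by rewrite expr2; nra.
have k0 : 0 < A * r ^+ 2 by rewrite mulr_gt0// exprn_gt0.
have s0 : 0 < s by lra.
(* [c] is the cosine of the angle of the chord with the curve, [w] the ratio of
   arc to chord. *)
have [c alc] : exists c, al = c * E by exists (al / E); rewrite divfK// lt0r_neq0.
have [w rw] : exists w, r = w * E by exists (r / E); rewrite divfK// lt0r_neq0.
have [q rhoq] : exists q, rho = q * E by exists (rho / E); rewrite divfK// lt0r_neq0.
have c1 : c <= 1 by rewrite -(ler_pM2r E0) mul1r -alc.
have c0 : 1 - A * r ^+ 2 <= c.
  rewrite -(ler_pM2r E0) -alc (le_trans _ al1)// ler_wpM2l//; lra.
have w1 : 1 <= w by rewrite -(ler_pM2r E0) mul1r -rw.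
have w2 : w <= 1 + 2 * (A * r ^+ 2).
  rewrite -(ler_pM2r E0) -rw; move: k0 kAr al1; move: (A * r ^+ 2) => k *; nra.
have q0 : 0 < q by rewrite -(pmulr_lgt0 _ E0) -rhoq.
have step1 : al * (rho - r) - A * r ^+ 2 * r <= be * b - al * a.
  have -> : a = b + (r - rho) by lra.
  have : - (A * r ^+ 2 * r) <= (be - al) * b by nra.
  move: (A * r ^+ 2 * r) => k; lra.
have step2 : G * (c * q - c * w - A * r * w ^+ 2) <= G / E ^+ 2 * (be * b - al * a).
  rewrite -[leRHS]mulrA ler_pM2l// [leRHS]mulrC ler_pdivlMr ?exprn_gt0//.
  apply: le_trans step1; rewrite alc rhoq rw le_eqVlt; apply/orP; left.
  by apply/eqP; ring.
apply: le_trans step2.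
have step3 : c * (G * (1 + s)) - P <= s * (G * (c * q)).
  have qE : rho / E = q by rewrite rhoq mulfK// lt0r_neq0.
  rewrite qE in T; nra.
have step4 : (1 - eta) * G - c * G - s * (G * (c - c * w - A * r * w ^+ 2)) <= 0.
  have -> : (1 - eta) * G - c * G - s * (G * (c - c * w - A * r * w ^+ 2)) =
    - (G * (eta - (1 - c) - s * (c * (w - 1)) - s * (A * r * w ^+ 2))) by ring.
  rewrite oppr_le0 mulr_ge0 ?(ltW G0)//.
  have cw : s * (c * (w - 1)) <= s * (2 * (A * r)).
    have : c * (w - 1) <= 1 * (w - 1) by rewrite ler_wpM2r// subr_ge0.
    rewrite ler_pM2l//; lra.
  have ww : s * (A * r * w ^+ 2) <= s * (A * r * 4).
    rewrite ler_pM2l// ler_pM2l// expr2; nra.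
  nra.
rewrite mulrA -mulrBl ler_pdivrMr//.
move: step3 step4; lra.
Qed.

(** * Geometry of the curve *)

Section Periodic.
Context {R : realType}.

Lemma periodic_int (T : Type) (f : R -> T) (t : R) (m : int) :
  (forall t, f (t + 1) = f t) -> f (t + m%:~R) = f t.
Proof.
move=> f1; elim/int_rec: m t => [t|n IHn t|n IHn t]; first by rewrite addr0.
  by rewrite intS intrD addrA IHn f1.
by rewrite -f1 -(IHn t) intS opprD intrD addrA addrAC addrNK.
Qed.

Lemma periodic_derive1 {V : normedModType R} (f : R -> V) (t : R) :
  (forall t, f (t + 1) = f t) -> derive1 f (t + 1) = derive1 f t.
Proof.
move=> f1; have e : (fun h => h^-1 *: (f (h + (t + 1)) - f (t + 1))) =
         (fun h => h^-1 *: (f (h + t) - f t)).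
  by apply/funext => h; rewrite addrA !f1.
by rewrite /derive1 e.
Qed.

Lemma periodic_bounded (f : R -> R) :
  continuous f -> (forall t, f (t + 1) = f t) -> exists M, forall t, `|f t| <= M.
Proof.
move=> fc f1.
have [||c _ cmax] := @EVT_max R (fun t => `|f t|) 0 1; first exact: ler01.
  apply: continuous_subspaceT => t.
  by apply: continuous_comp; [exact: fc|exact: norm_continuous].
exists `|f c| => t; rewrite -(periodic_int _ f t (- Num.floor t) f1).
apply: cmax; rewrite in_itv/= intrN subr_ge0 floor_le/= lerBlDl.
by have := floorD1_gt t; rewrite intrD => /ltW.
Qed.

End Periodic.

Section Curve.
Context {R : realType} {d : nat} (x : R -> 'rV[R]_d).
Context (x_class4 : curve_of_class 4 x) (x_closed : arclength_closed_curve x).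
Implicit Types (t y z r : R).

Let x_unit t : enorm (derive1 x t) = 1. Proof. by case: x_closed. Qed.
Let x_per t : x (t + 1) = x t. Proof. by case: x_closed. Qed.

Lemma is_derive_coord (f : R -> 'rV[R]_d) t (k : 'I_d) :
  derivable f t 1 -> is_derive t 1 (fun p => f p 0 k) (derive1 f t 0 k).
Proof.
move=> fd; have /(_ 0 k) fdk := (derivable_mxP f t 1).1 fd.
by apply: DeriveDef => //; rewrite derive1E derive_mx// mxE.
Qed.

Lemma curve_derivable t : derivable x t 1.
Proof. by have [/(_ 0%N t isT)] := x_class4. Qed.

Lemma is_derive_curve t (k : 'I_d) :
  is_derive t 1 (fun p => x p 0 k) (derive1 x t 0 k).
Proof. exact/is_derive_coord/curve_derivable. Qed.

Lemma curve_speed_lipschitz (k : 'I_d) : exists M, forall p q,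
  `|derive1 x p 0 k - derive1 x q 0 k| <= M * `|p - q|.
Proof.
have [xd _] := x_class4.
have d2 t : is_derive t 1 (fun p => derive1 x p 0 k) (derive1 (derive1 x) t 0 k).
  by apply: is_derive_coord; have := xd 1%N t isT.
have d3 t : is_derive t 1 (fun p => derive1 (derive1 x) p 0 k)
    (derive1 (derive1 (derive1 x)) t 0 k).
  by apply: is_derive_coord; have := xd 2%N t isT.
have [||M xM] := @periodic_bounded R (fun p => derive1 (derive1 x) p 0 k).
- by move=> t; apply/differentiable_continuous/derivable1_diffP; case: (d3 t).
- by move=> t; rewrite (periodic_derive1 _ t (fun p => periodic_derive1 x p x_per)).
exists M => p q; wlog pq : p q / p <= q => [h|].
  by have [/h//|/ltW/h qp] := leP p q; rewrite distrC (distrC p).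
rewrite distrC (distrC p).
have [|c _ ->] := MVT_segment pq (fun t _ => d2 t).
  apply: continuous_subspaceT => t.
  by apply/differentiable_continuous/derivable1_diffP; case: (d2 t).
by rewrite normrM ler_wpM2r.
Qed.

(** Two unit vectors at distance at most [L r] have inner product at least
    [1 - L^2 r^2 / 2]: turning costs only to second order. *)
Lemma curve_tangents : exists2 A, 0 < A & forall p q,
  1 - A * (p - q) ^+ 2 <= dot (derive1 x p) (derive1 x q).
Proof.
have [M xM] := @fin_all_exists _ _ _ curve_speed_lipschitz.
exists (1 + \sum_(k < d) M k ^+ 2).
  by rewrite ltr_pwDl// sumr_ge0// => k _; exact: sqr_ge0.
move=> p q; rewrite dot_unit// lerD2l lerN2.
have : dot (derive1 x p - derive1 x q) (derive1 x p - derive1 x q) <=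
    (\sum_(k < d) M k ^+ 2) * (p - q) ^+ 2.
  rewrite mulr_suml ler_sum// => k _; rewrite -expr2 -exprMn !mxE.
  rewrite -real_normK ?num_real// -[leRHS]real_normK ?num_real//.
  rewrite ler_pXn2r ?nnegrE// (le_trans (xM k p q))//.
  by rewrite [leRHS]normrM ler_wpM2r// ler_norm.
have : 0 <= \sum_(k < d) M k ^+ 2 by apply: sumr_ge0 => k _; exact: sqr_ge0.
have := sqr_ge0 (p - q); nra.
Qed.

Lemma chord_MVT y z u : z < y ->
  exists2 c, c \in `]z, y[ & dot (x y - x z) u = dot (derive1 x c) u * (y - z).
Proof.
move=> zy; have dx t := is_derive_dotl x t _ u (is_derive_curve t).
have [|c cyz e] := MVT zy (fun t _ => dx t); last by exists c; rewrite ?dotBl.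
apply: continuous_subspaceT => t.
by apply/differentiable_continuous/derivable1_diffP; case: (dx t).
Qed.

Lemma chord_le y z : z < y -> enorm (x y - x z) <= y - z.
Proof.
move=> zy; have [->|v0] := eqVneq (x y - x z) 0.
  by rewrite enorm0 subr_ge0 ltW.
have [c _ e] := chord_MVT y z (x y - x z) zy.
rewrite -(ler_pM2l (enorm_gt0 _ v0)) -expr2 sqr_enorm e ler_wpM2r ?subr_ge0 ?(ltW zy)//.
by rewrite dotC (le_trans (ler_norm _))// norm_dot_unit.
Qed.

(** By the mean value theorem for [p |-> x p . x' t] the projection of a chord
    on a tangent of its arc is [r] times the inner product of two tangents. *)
Lemma chord_tangent_ge A y z t :
  (forall p q, 1 - A * (p - q) ^+ 2 <= dot (derive1 x p) (derive1 x q)) ->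
  0 <= A -> z < y -> z <= t <= y ->
  (1 - A * (y - z) ^+ 2) * (y - z) <= dot (x y - x z) (derive1 x t).
Proof.
move=> xA A0 zy /andP[zt ty]; have [c] := chord_MVT y z (derive1 x t) zy.
rewrite in_itv/= => /andP[zc cy] ->; rewrite ler_wpM2r ?subr_ge0 ?(ltW zy)//.
apply: le_trans (xA _ _); rewrite lerD2l lerN2 ler_wpM2l//.
nra.
Qed.

(** * Estimates for one pair of points *)

(** The time derivative of [W s (x y - x z)] when [y] and [z] move at the
    speeds [a] and [b]. *)
Definition pair_variation s y z a b : R :=
  dot (grad (W s) (x y - x z)) (derive1 x y) * a +
  dot (grad (W s) (x z - x y)) (derive1 x z) * b.

Lemma pair_variationC s y z a b :
  pair_variation s y z a b = pair_variation s z y b a.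
Proof. exact: addrC. Qed.

Lemma pair_variation_per s y z a b :
  pair_variation s (y + 1) z a b = pair_variation s y z a b.
Proof. by rewrite /pair_variation !x_per periodic_derive1. Qed.

Lemma pair_variationE s y z a b : s != 0 -> x y != x z ->
  pair_variation s y z a b =
  enorm (x y - x z) `^ (- s - 2) *
  (dot (x y - x z) (derive1 x z) * b - dot (x y - x z) (derive1 x y) * a).
Proof.
rewrite -(subr_eq0 (x y)) => s0 v0; rewrite /pair_variation -(opprB (x y) (x z)).
have w0 : - (x y - x z) != 0 by rewrite oppr_eq0.
rewrite [X in _ + X * b](dot_grad_W s _ (derive1 x z) s0 w0).
rewrite [X in X * a + _](dot_grad_W s _ (derive1 x y) s0 v0) enormN dotNl.
move: (enorm _ `^ _) (dot _ _) (dot _ _) => P p q; ring.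
Qed.

(** At short distance [r = y - z] the curve is straight up to a relative error
    [O(r^2)]. With [E] the length of the chord, a displacement that changes [r]
    at the rate [a - b = r - rho] gives the variation [E^-s (rho / r - 1)], which
    the tangent inequality for [u |-> u^-s / s] bounds below by
    [(E^-s - rho^-s) / s]. The common displacement [b] is only bounded by 1,
    not by [r], and the error that it causes has relative size [O(r)]. *)
Lemma pair_variation_near s eta : 1 < s -> 0 < eta -> eta <= 1 / 2 ->
  exists delta, [/\ 0 < delta, delta <= 1 / 4 & forall y z a b rho,
    z < y -> y - z <= delta -> 0 < rho -> `|b| <= 1 -> a - b = (y - z) - rho ->
    (1 - eta) * W s (x y - x z) - rho `^ (- s) / s <= pair_variation s y z a b].
Proof.
move=> s1 eta0 eta1; have [A A0 xA] := curve_tangents.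
have K0 : 0 < (1 + 6 * s) * A + 2 by nra.
(* This bounds [r], [A r] and [(1 + 6 s) A r] in terms of [eta]. *)
exists (eta / ((1 + 6 * s) * A + 2)); split; first by rewrite divr_gt0.
  by rewrite ler_pdivrMr//; nra.
move=> y z a b rho zy; rewrite ler_pdivlMr// => yz rho0 b1 ab.
have r0 : 0 < y - z by rewrite subr_gt0.
have k1 : 0 < (1 - A * (y - z) ^+ 2) * (y - z).
  rewrite mulr_gt0// subr_gt0; move: (y - z) r0 yz => r r0 yz.
  have r1 : r <= 1 / 4 by nra.
  have Ar : A * r <= 1 / 2 by nra.
  rewrite expr2 mulrA; nra.
have ty : z <= y <= y by rewrite lexx ltW.
have tz : z <= z <= y by rewrite lexx ltW.
have al1 := chord_tangent_ge A y z y xA (ltW A0) zy ty.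
have be1 := chord_tangent_ge A y z z xA (ltW A0) zy tz.
have /ler_normlP[_ alE] := norm_dot_unit _ (x y - x z) (x_unit y).
have /ler_normlP[_ beE] := norm_dot_unit _ (x y - x z) (x_unit z).
have Er := chord_le y z zy.
have s0 : 0 < s by exact: lt_trans s1.
have [E0|E0] := eqVneq (x y - x z) 0.
  by have := lt_le_trans k1 (le_trans al1 alE); rewrite E0 enorm0 ltxx.
have T := powR_tangent_le s rho _ (ltW s0) rho0 (enorm_gt0 _ E0).
rewrite pair_variationE ?(lt0r_neq0 s0)//; last by rewrite -(subr_eq0 (x y)).
rewrite /W powRD; last by rewrite (lt0r_neq0 (enorm_gt0 _ E0)) implybT.
rewrite (powR_invn 2 (enorm_ge0 _)).
have G0 := powR_gt0 (- s) (enorm_gt0 _ E0); have P0 := powR_gt0 (- s) rho0.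
have := enorm_gt0 _ E0.
move: G0 P0 T al1 be1 alE beE Er r0 yz ab.
move: (enorm _ `^ _) (rho `^ _) => G P.
move: (dot _ (derive1 x y)) (dot _ (derive1 x z)) (enorm _) (y - z).
move=> al be E r G0 P0 T al1 be1 alE beE Er r0 yz ab E0'.
exact: (short_chord_estimate s eta A r E al be a b rho G P).
Qed.

(** The chord is a continuous function of its starting point and of its arc
    length, and it vanishes nowhere on the compact set considered, since the
    curve does not meet itself. *)
Lemma chord_far delta : 0 < delta -> delta <= 1 / 4 ->
  exists2 m, 0 < m & forall y z, delta <= y - z -> y - z <= 1 - delta ->
    m <= enorm (x y - x z).
Proof.
move=> d0 d1.
pose F (p : R * R) := dot (x (p.1 + p.2) - x p.1) (x (p.1 + p.2) - x p.1).
pose K := `[0, 1]%classic `*` `[delta, 1 - delta]%classic : set (R * R).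
have K0 : K !=set0.
  by exists (0, delta); split => /=; rewrite in_itv/= lexx ?ler01//; lra.
have cK : compact K by apply: compact_setX; exact: segment_compact.
have Fc : continuous F.
  have xc (k : 'I_d) (f : R * R -> R) :
      continuous f -> continuous (fun p => x (f p) 0 k).
    move=> fc p; apply: (@continuous_comp _ _ _ f (fun t => x t 0 k)); first exact: fc.
    by apply/differentiable_continuous/derivable1_diffP; case: (is_derive_curve (f p) k).
  have -> : F = fun p => \sum_(k < d)
      (x (p.1 + p.2) 0 k - x p.1 0 k) * (x (p.1 + p.2) 0 k - x p.1 0 k).
    by apply/funext => p; apply: eq_bigr => k _; rewrite !mxE.
  have c1 : continuous (fun q : R * R => q.1 + q.2).
    by move=> q; apply: cvgD; [exact: cvg_fst|exact: cvg_snd].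
  have c2 : continuous (fst : R * R -> R) by move=> q; exact: cvg_fst.
  have gc (k : 'I_d) : continuous (fun p : R * R =>
      (x (p.1 + p.2) 0 k - x p.1 0 k) * (x (p.1 + p.2) 0 k - x p.1 0 k)).
    move=> p; have h := cvgB (xc k _ c1 p) (xc k _ c2 p).
    by apply: cvgM; exact: h.
  exact: (@continuous_big R^o 'I_d +%R 0 xpredT (@add_continuous R^o) _
    (index_enum 'I_d) _ (fun k _ => gc k)).
have [c] := compact_EVT_min K0 cK (continuous_subspaceT Fc).
rewrite inE => -[_]; rewrite /= in_itv/= => /andP[c1 c2] cmin.
exists (Num.sqrt (F c)).
  rewrite sqrtr_gt0 dotvv_gt0// subr_eq0; apply/eqP.
  have [_ _ inj] := x_closed; move=> /inj[m].
  rewrite addrAC subrr add0r => cm; move: c1 c2; rewrite cm => m0 m1.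
  have : 0 < m%:~R :> R by lra.
  have : m%:~R < 1%:~R :> R by rewrite (_ : 1%:~R = 1)//; lra.
  by rewrite ltr_int ltr0z; case: m {cm m0 m1} => [[|[|n]]|n].
move=> y z yz1 yz2; rewrite ler_sqrt ?dotvv_ge0//.
have xi t (m : int) : x (t + m%:~R) = x t by apply: periodic_int.
(* By periodicity the starting point may be taken in [[0, 1]]. *)
have := cmin (z - (Num.floor z)%:~R, y - z).
rewrite /F/= (_ : _ + (y - z) = y - (Num.floor z)%:~R); last by ring.
rewrite -!intrN !xi; apply.
rewrite inE; split => /=; rewrite in_itv/= ?yz1//.
rewrite intrN subr_ge0 floor_le/= lerBlDl.
by have := floorD1_gt z; rewrite intrD => /ltW.
Qed.

Lemma pair_variation_far s delta : 1 < s -> 0 < delta -> delta <= 1 / 4 ->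
  exists2 C, 0 <= C & forall y z a b,
    delta <= y - z -> y - z <= 1 - delta -> `|a| <= 1 -> `|b| <= 1 ->
    W s (x y - x z) - C <= pair_variation s y z a b.
Proof.
move=> s1 d0 d1; have [m m0 xm] := chord_far delta d0 d1.
have s0 : 0 < s by lra.
exists (m `^ (- s) / s + 2 * m `^ (- (s + 2))).
  by rewrite addr_ge0 ?mulr_ge0 ?powR_ge0// invr_ge0 ltW.
have s2 : 0 <= s + 2 by rewrite addr_ge0// ltW.
have key (be al P Q w c : R) : `|be| <= 1 -> `|al| <= 1 -> 0 <= P -> P <= Q ->
    w <= c -> w - (c + 2 * Q) <= P * (be - al).
  move=> /ler_normlP[h1 h2] /ler_normlP[h3 h4] P0 PQ wc.
  have : - (2 * Q) <= P * (be - al) by nra.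
  lra.
move=> y z a b yz1 yz2 a1 b1; have E1 := xm y z yz1 yz2.
have zy : z < y by rewrite -subr_gt0; exact: lt_le_trans yz1.
have Er : enorm (x y - x z) <= 1 by have := chord_le y z zy; lra.
have xyz : x y != x z.
  apply: contraTneq E1 => ->.
  by rewrite subrr enorm0 -ltNge.
rewrite pair_variationE ?lt0r_neq0// /W.
have WC : enorm (x y - x z) `^ (- s) / s <= m `^ (- s) / s.
  by rewrite ler_pM2r ?invr_gt0// powR_antitone// ltW.
have dE (u v : 'rV[R]_d) (w : R) :
    enorm u = 1 -> enorm v <= 1 -> `|w| <= 1 -> `|dot v u * w| <= 1.
  move=> u1 v1 w1; rewrite normrM mulr_ile1//.
  exact: le_trans (norm_dot_unit _ _ u1) v1.
have be1 := dE _ _ _ (x_unit z) Er b1.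
have al1 := dE _ _ _ (x_unit y) Er a1.
rewrite (_ : - s - 2 = - (s + 2)); last by ring.
have PQ := powR_antitone (s + 2) m _ s2 m0 E1.
exact: (key _ _ _ _ _ _ be1 al1 (powR_ge0 _ _) PQ WC).
Qed.

(** The two points are close along one of the two arcs between them, or far
    apart. In the first two cases one of the two subtracted powers is needed,
    and the sum of both serves in every case. *)
Lemma pair_variation_ge s eta : 1 < s -> 0 < eta -> eta <= 1 / 2 ->
  exists2 C, 0 <= C & forall y z a b rho,
    z < y -> y < z + 1 -> 0 < rho -> rho < 1 -> `|a| <= 1 -> `|b| <= 1 ->
    a - b = (y - z) - rho ->
    (1 - eta) * W s (x y - x z) - (rho `^ (- s) + (1 - rho) `^ (- s)) / s - C
      <= pair_variation s y z a b.
Proof.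
move=> s1 eta0 eta1.
have [delta [d0 d1 near_le]] := pair_variation_near s eta s1 eta0 eta1.
have [C C0 far_le] := pair_variation_far s delta s1 d0 d1.
exists C => // y z a b rho zy yz rho0 rho1 a1 b1 ab.
have s0 : 0 < s by lra.
have P0 : 0 <= rho `^ (- s) / s by rewrite divr_ge0 ?powR_ge0// ltW.
have Q0 : 0 <= (1 - rho) `^ (- s) / s by rewrite divr_ge0 ?powR_ge0// ltW.
rewrite mulrDl; have [yz1|yz1] := leP (y - z) delta.
  by have := near_le y z a b rho zy yz1 rho0 b1 ab; lra.
have [yz2|yz2] := leP (y - z) (1 - delta).
  have := far_le y z a b (ltW yz1) yz2 a1 b1.
  have : 0 <= eta * W s (x y - x z) by rewrite mulr_ge0 ?W_ge0// ltW.
  lra.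
have := near_le (z + 1) y b a (1 - rho).
rewrite pair_variation_per pair_variationC x_per -(opprB (x y)) WN.
move=> /(_ yz _ _ a1 _) h; have {}h := h ltac:(lra) ltac:(lra) ltac:(lra).
lra.
Qed.

End Curve.

(** * Coercivity of the energy *)

Section Coercivity.
Context {R : realType} {d : nat} (x : R -> 'rV[R]_d).
Context (x_class4 : curve_of_class 4 x) (x_closed : arclength_closed_curve x).
Context (s : R) (s1 : 1 < s).

Lemma sum_velocity (N : nat) (Z a : 'I_N -> R) :
  \sum_(i < N) velocity s x Z i * a i =
  - N%:R `^ (- s) *
  \sum_(i < N) \sum_(j < N | (i < j)%N) pair_variation x s (Z i) (Z j) (a i) (a j).
Proof.
pose F i j := dot (grad (W s) (x (Z i) - x (Z j))) (derive1 x (Z i)) * a i.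
rewrite [in RHS](sum_pairs_sym _ _ F) mulr_sumr; apply: eq_bigr => i _.
by rewrite /velocity -mulrA mulr_suml.
Qed.

(** The direction [a] points from the equidistant configuration with the same
    first point to [Z]. The pair estimates are summed: the powers of [rho] add up
    to a partial sum of the series of [zetat s], and the constants of the fewer than [N ^ 2] pairs to
    [C N ^ (1 - s)]. *)
Lemma coercivity eta : 0 < eta -> eta <= 1 / 2 ->
  exists2 C, 0 <= C & forall (N : nat) (Z : 'I_N.+1 -> R),
    (forall i j : 'I_N.+1, (i < j)%N -> Z i < Z j < Z i + 1) ->
    exists2 a : 'I_N.+1 -> R, (forall i, `|a i| <= 1) &
      (1 - eta) * energy s x Z - zetat s - C * N.+1%:R `^ (1 - s) <=
      - (N.+1%:R^-1 * \sum_(i < N.+1) velocity s x Z i * a i).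
Proof.
move=> eta0 eta1.
have [C C0 pair_ge] := pair_variation_ge x x_class4 x_closed s eta s1 eta0 eta1.
exists C => // N Z Zord; set n := N.+1; have n0 : 0 < n%:R :> R by rewrite ltr0n.
have s0 : 0 < s by exact: lt_trans s1.
pose a (i : 'I_n) := Z i - Z ord0 - i%:R / n%:R.
have a1 i : `|a i| <= 1.
  have i0 : 0 <= i%:R / n%:R :> R by rewrite divr_ge0.
  have i1 : i%:R / n%:R <= 1 :> R.
    by rewrite ler_pdivrMr// mul1r ler_nat ltnW.
  have : Z ord0 <= Z i <= Z ord0 + 1.
    have [->|i_neq0] := eqVneq i ord0; first by rewrite lexx lerDl ler01.
    have /Zord/andP[h1 h2] : (@ord0 N < i)%N by rewrite lt0n.
    by rewrite (ltW h1) (ltW h2).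
  by move=> /andP[h1 h2]; rewrite ler_norml /a; apply/andP; split; lra.
exists a => //; rewrite sum_velocity -/n.
pose f (k : nat) : R := k%:R `^ (- s).
have pair_le (i j : 'I_n) : (i < j)%N ->
    (1 - eta) * W s (x (Z i) - x (Z j))
      - n%:R `^ s / s * (f (j - i)%N + f (n - (j - i))%N) - C <=
    pair_variation x s (Z i) (Z j) (a i) (a j).
  move=> ij; have /andP[Z1 Z2] := Zord i j ij.
  rewrite pair_variationC -(opprB (x (Z j))) WN.
  have k0 : (0 < j - i)%N by rewrite subn_gt0.
  have kn : (j - i < n)%N by apply: leq_ltn_trans (leq_subr i j) (ltn_ord j).
  pose rho : R := (j - i)%:R / n%:R.
  have rho0 : 0 < rho by rewrite divr_gt0// ltr0n.
  have rho1 : rho < 1 by rewrite ltr_pdivrMr// mul1r ltr_nat.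
  have aji : a j - a i = Z j - Z i - rho.
    rewrite /a /rho natrB 1?ltnW//; field; exact: lt0r_neq0.
  have fE (k : nat) : (0 < k)%N -> n%:R `^ s * f k = (k%:R / n%:R) `^ (- s).
    move=> k_gt0; rewrite powRM ?invr_ge0// mulrC; congr (_ * _).
    by rewrite -powR_inv1// -powRrM mulN1r opprK.
  have rhoE : 1 - rho = (n - (j - i))%:R / n%:R.
    by rewrite /rho (natrB _ (ltnW kn)) mulrBl divff// lt0r_neq0.
  have nk0 : (0 < n - (j - i))%N by rewrite subn_gt0.
  have := pair_ge (Z j) (Z i) (a j) (a i) rho Z1 Z2 rho0 rho1 (a1 j) (a1 i) aji.
  rewrite rhoE -(fE _ k0) -(fE _ nk0) -mulrDr.
  by rewrite [X in _ - X - _ <= _]mulrAC.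
have nE : n%:R^-1 = n%:R `^ (-1) :> R by rewrite powR_inv1// ltW.
have nn0 : n%:R != 0 :> R by exact: lt0r_neq0.
have -> : forall S : R,
    - (n%:R^-1 * (- n%:R `^ (- s) * S)) = n%:R `^ (- s - 1) * S.
  move=> S; rewrite mulNr mulrN opprK mulrA nE -powRD ?nn0 ?implybT//.
  by rewrite addrC.
have M0 : 0 < n%:R `^ (- s - 1) :> R by rewrite powR_gt0.
have sum_le : \sum_(i < n) \sum_(j < n | (i < j)%N)
    ((1 - eta) * W s (x (Z i) - x (Z j))
      - n%:R `^ s / s * (f (j - i)%N + f (n - (j - i))%N) - C) <=
  \sum_(i < n) \sum_(j < n | (i < j)%N)
    pair_variation x s (Z i) (Z j) (a i) (a j).
  by apply: ler_sum => i _; apply: ler_sum => j; exact: pair_le.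
rewrite -(ler_pM2l M0) in sum_le; apply: le_trans sum_le.
under [X in _ <= _ * X]eq_bigr do rewrite !sumrB -!mulr_sumr.
rewrite !sumrB -!mulr_sumr (sum_cyclic_distances _ n f).
rewrite !mulrBr; apply: lerB; first apply: lerB.
- by rewrite /energy mulrCA.
- have fz : \sum_(1 <= k < n) f k <= zeta s by exact: zeta_partial_le.
  have -> : n%:R `^ (- s - 1) * (n%:R `^ s / s * ((\sum_(1 <= k < n) f k) *+ n)) =
      (n%:R `^ (- s - 1) * (n%:R `^ s * n%:R)) * ((\sum_(1 <= k < n) f k) / s).
    by rewrite -[_ *+ n]mulr_natr; ring.
  rewrite -[X in _ * (_ * X) * _](powRr1 (ltW n0)) -!powRD ?nn0 ?implybT//.
  rewrite (_ : - s - 1 + (s + 1) = 0); last by ring.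
  by rewrite powRr0 mul1r ler_pM2r ?invr_gt0.
have -> : C * n%:R `^ (1 - s) = n%:R `^ (- s - 1) * (C * (n%:R * n%:R)).
  rewrite [RHS]mulrCA; congr (_ * _).
  rewrite -[X in _ = _ * (X * X)](powRr1 (ltW n0)) -!powRD ?nn0 ?implybT//.
  by congr (_ `^ _); ring.
rewrite ler_pM2l//.
have -> : C * (n%:R * n%:R) = \sum_(i < n) \sum_(j < n) C.
  by rewrite !sumr_const !card_ord -mulrnA -[RHS]mulr_natr natrM.
apply: ler_sum => i _; rewrite [leRHS](bigID (fun j : 'I_n => (i < j)%N)) /=.
by rewrite lerDl sumr_ge0.
Qed.

End Coercivity.

(** * Gradient flow *)

Section Calculus.
Context {R : realType}.
Implicit Types f df : R -> R.

Lemma is_derive_bigsum (I : Type) (r : seq I) (P : pred I) (f : I -> R -> R)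
    (df : I -> R) (t : R) :
  (forall i, P i -> is_derive t 1 (f i) (df i)) ->
  is_derive t 1 (fun p => \sum_(i <- r | P i) f i p) (\sum_(i <- r | P i) df i).
Proof.
move=> fd; elim: r => [|i r IHr].
  apply: is_derive1_ext (is_derive_cst (0 : R) t 1) _ _ => [p|]; rewrite big_nil//.
rewrite big_cons; under eq_fun do rewrite big_cons.
by case: ifPn => // Pi; have fi := fd i Pi; apply: is_deriveD.
Qed.

(** If [l < f b] then [l < f] on the whole interval, since [f] does not increase,
    and [1 / f] grows at rate at least [1 / 4]. This forces [f b < 4 / (b - a)],
    whatever the value of [f a]. *)
Lemma quadratic_decay f df (l a b : R) : a < b -> 0 < l -> 4 <= l * (b - a) ->
  (forall t, a <= t <= b -> is_derive t 1 f (df t)) ->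
  (forall t, a <= t <= b -> df t <= 0) ->
  (forall t, a <= t <= b -> l <= f t -> df t <= - (f t / 2) ^+ 2) ->
  f b <= l.
Proof.
move=> ab l0 lab fd df0 dfl; rewrite leNgt; apply/negP => lfb.
have f_large t : a <= t <= b -> l < f t.
  move=> /andP[at_ tb]; apply: lt_le_trans lfb _.
  have fdt u : u \in `]t, b[ -> is_derive u 1 f (df u).
    rewrite in_itv/= => /andP[tu ub]; apply: fd.
    by rewrite (le_trans at_ (ltW tu)) ltW.
  have ft : {within `[t, b], continuous f}.
    apply: derivable_within_continuous => u; rewrite in_itv/= => /andP[tu ub].
    by have [] := fd u; rewrite ?(le_trans at_ tu).
  have [c] := MVT_segment tb fdt ft; rewrite in_itv/= => /andP[tc cb] e.
  rewrite -subr_le0 e mulr_le0_ge0 ?subr_ge0// df0//.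
  by rewrite (le_trans at_ tc).
have abt u : u \in `[a, b] -> a <= u <= b by rewrite in_itv.
have f_neq0 u : a <= u <= b -> f u != 0.
  by move=> /f_large lu; rewrite lt0r_neq0// (lt_trans l0).
have ud u : u \in `[a, b] ->
    is_derive u 1 (fun p => (f p)^-1) (- (f u ^- 2) * df u).
  by move=> /abt uab; apply: is_deriveV; [exact: f_neq0|exact: fd].
have uc : {within `[a, b], continuous (fun p => (f p)^-1)}.
  by apply: derivable_within_continuous => u /ud[].
have [c cab] := MVT_segment (ltW ab) (fun u uab => ud u (subset_itv_oo_cc uab)) uc.
have fc := f_large c (abt c cab); have fc0 : 0 < f c by exact: lt_trans fc.
have : 1 / 4 <= - (f c ^- 2) * df c.
  have dfc := dfl c (abt c cab) (ltW fc).
  rewrite mulNr -mulrN [leRHS]mulrC ler_pdivlMr ?exprn_gt0//.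
  by move: dfc; rewrite expr_div_n; lra.
have fa0 : 0 < (f a)^-1.
  by rewrite invr_gt0 (lt_trans l0)// f_large// lexx ltW.
have fbl : (f b)^-1 < l^-1 by rewrite ltf_pV2// posrE (lt_trans l0).
have lba : l^-1 <= (b - a) / 4.
  by rewrite -(ler_pM2l l0) divff ?lt0r_neq0// mulrA ler_pdivlMr// mul1r.
have ba0 : 0 < b - a by rewrite subr_gt0.
move: (_ * df c) => D D4 e; have : 1 / 4 * (b - a) <= D * (b - a).
  by rewrite ler_pM2r.
lra.
Qed.

(** Cauchy-Schwarz, as positivity of the mean of [(v - m a) ^ 2] for [m] the
    mean of [v a]. *)
Lemma sqr_mean_le (n : nat) (v a : 'I_n.+1 -> R) : (forall i, `|a i| <= 1) ->
  (n.+1%:R^-1 * \sum_(i < n.+1) v i * a i) ^+ 2 <=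
  n.+1%:R^-1 * \sum_(i < n.+1) v i * v i.
Proof.
move=> a1; set m := _ * \sum_i v i * a i.
have n0 : 0 < n.+1%:R^-1 :> R by rewrite invr_gt0 ltr0n.
have : 0 <= n.+1%:R^-1 * \sum_(i < n.+1) (v i - m * a i) ^+ 2.
  by rewrite mulr_ge0 ?(ltW n0)// sumr_ge0// => i _; exact: sqr_ge0.
have -> : \sum_(i < n.+1) (v i - m * a i) ^+ 2 =
    \sum_(i < n.+1) v i * v i - 2 * m * \sum_(i < n.+1) v i * a i +
    m ^+ 2 * \sum_(i < n.+1) a i ^+ 2.
  rewrite !mulr_sumr -sumrB -big_split; apply: eq_bigr => i _ /=; ring.
have A1 : n.+1%:R^-1 * \sum_(i < n.+1) a i ^+ 2 <= 1.
  rewrite mulrC ler_pdivrMr ?ltr0n// mul1r.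
  rewrite -[X in _ <= X%:R]card_ord -[leRHS]mulr1n -sumr_const.
  apply: ler_sum => i _; rewrite -real_normK ?num_real//.
  by rewrite expr_le1.
have : m ^+ 2 * (n.+1%:R^-1 * \sum_(i < n.+1) a i ^+ 2) <= m ^+ 2 * 1.
  by rewrite ler_wpM2l ?sqr_ge0.
have mE : m ^+ 2 = m * (n.+1%:R^-1 * \sum_(i < n.+1) v i * a i) by [].
move: mE; move: (\sum_(i < n.+1) v i * v i) (\sum_(i < n.+1) a i ^+ 2).
move: (\sum_(i < n.+1) v i * a i) (n.+1%:R^-1) => va k vv aa mE h1 h2.
rewrite !mulrDr mulrN in h2; lra.
Qed.

End Calculus.

Section Dynamics.
Context {R : realType} {d : nat} (x : R -> 'rV[R]_d).
Context (x_class4 : curve_of_class 4 x) (x_closed : arclength_closed_curve x).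
Context (s : R) (s1 : 1 < s) (N : nat) (z : 'I_N -> R -> R).
Context (z_sol : is_solution s x z).

Lemma solution_near (t : R) i (e : R) : 0 <= t -> 0 < e -> \forall u \near t,
  u != t -> 0 <= u ->
  `|velocity s x (fun j => z j t) i - (z i u - z i t) / (u - t)| < e.
Proof.
by move=> t0 e0; have [_ /(_ t t0 i) /cvgrPdist_lt /(_ e e0)] := z_sol.
Qed.

Lemma solution_is_derive (t : R) i : 0 < t ->
  is_derive t 1 (z i) (velocity s x (fun j => z j t) i).
Proof.
move=> t0; set v := velocity _ _ _ _.
apply/is_derive1_caratheodory.
exists (fun u => if u == t then v else (z i u - z i t) / (u - t)); split.
- move=> u; case: eqVneq => [->|ut]; first by rewrite !subrr mulr0.
  by rewrite divfK// subr_eq0.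
- apply/cvgrPdist_lt => e e0 /=; rewrite eqxx.
  have z_near := solution_near t i e (ltW t0) e0.
  near=> u; case: eqVneq => [_|ut]; first by rewrite subrr normr0.
  have u0 : 0 <= u by near: u; exact: lt_le_nbhsr.
  exact: (near z_near u).
- by rewrite eqxx.
Unshelve. all: by end_near. Qed.

Lemma solution_continuous (T : R) i : 0 < T -> {within `[0, T], continuous (z i)}.
Proof.
move=> T0; have zc t : 0 < t -> {for t, continuous (z i)}.
  move=> t0; apply/differentiable_continuous/derivable1_diffP.
  by case: (solution_is_derive t i t0).
apply/continuous_within_itvP => //; split.
- by move=> t; rewrite in_itv/= => /andP[t0 _]; exact: zc.
- apply/cvgrPdist_lt => e e0; set v := velocity s x (fun j => z j 0) i.
  have K0 : 0 < `|v| + 1 by rewrite ltr_wpDl.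
  have z_near : \forall u \near 0^'+, `|v - (z i u - z i 0) / (u - 0)| < 1.
    apply: (@filterS _ (nbhs (0 : R)) _ _ _ _ (solution_near 0 i 1 (lexx _) ltr01)).
    by move=> u h u0; apply: h; [exact: lt0r_neq0|exact: ltW].
  near=> u; have u0 : 0 < u by near: u; exact: nbhs_right_gt.
  have : `|v - (z i u - z i 0) / (u - 0)| < 1.
    exact: (near z_near u).
  have ue : u < e / (`|v| + 1) by near: u; apply: nbhs_right_lt; rewrite divr_gt0.
  rewrite ltr_pdivlMr// in ue.
  rewrite subr0 => h; apply: le_lt_trans ue.
  have -> : z i 0 - z i u = u * - ((z i u - z i 0) / u).
    by rewrite mulrN mulrCA divff ?lt0r_neq0// mulr1 opprB.
  rewrite normrM (gtr0_norm u0) normrN ler_pM2l//.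
  have := ler_normB v (v - (z i u - z i 0) / u); rewrite opprB addrC subrK.
  lra.
- by apply: cvg_at_left_filter; exact: zc.
Unshelve. all: by end_near. Qed.

(** Two particles never meet on the curve, so the continuous function [z j - z i]
    omits the integers. *)
Lemma solution_gap i j (t : R) : i != j -> 0 <= t ->
  z i 0 < z j 0 < z i 0 + 1 -> z i t < z j t < z i t + 1.
Proof.
move=> ij; rewrite le_eqVlt => /predU1P[<-//|t0] /andP[g0 g1].
have [coll _] := z_sol; have [_ x_per _] := x_closed.
have gc : {within `[0, t], continuous (z j - z i)}.
  move=> u; apply: cvgB; exact: solution_continuous.
have no_int (m : int) c : c \in `[0, t] -> z j c - z i c != m%:~R.
  rewrite in_itv/= => /andP[c0 _]; apply/eqP => e.
  have := coll c c0 i j ij; apply.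
  by rewrite -(periodic_int _ x (z i c) m x_per) -e addrC subrK.
apply/andP; split; rewrite ltNge; apply/negP => h.
- have [|c ct] := @IVT _ _ _ _ 0 (ltW t0) gc.
    by rewrite ge_min le_max !fctE; apply/andP; split; apply/orP; [right|left]; lra.
  by move=> /eqP; rewrite (negbTE (no_int 0 c ct)).
- have [|c ct] := @IVT _ _ _ _ 1 (ltW t0) gc.
    by rewrite ge_min le_max !fctE; apply/andP; split; apply/orP; [left|right]; lra.
  by move=> /eqP; rewrite (negbTE (no_int 1 c ct)).
Qed.

Lemma energy_is_derive (t : R) : 0 < t ->
  is_derive t 1 (fun p => energy s x (fun i => z i p))
    (- (N%:R^-1 * \sum_(i < N) velocity s x (fun j => z j t) i *
                               velocity s x (fun j => z j t) i)).
Proof.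
move=> t0; set v := velocity _ _ _.
have s0 : s != 0 by rewrite lt0r_neq0// (lt_trans ltr01).
have [coll _] := z_sol.
have dpair (i j : 'I_N) : (i < j)%N -> is_derive t 1
    (fun p => W s (x (z i p) - x (z j p)))
    (pair_variation x s (z i t) (z j t) (v i) (v j)).
  move=> ij; have neq : x (z i t) != x (z j t).
    by apply/eqP/coll; [exact: ltW|rewrite -val_eqE /= ltn_eqF].
  pose df := v i *: derive1 x (z i t) - v j *: derive1 x (z j t).
  have dcoord l k : is_derive t 1 (fun p => x (z l p) 0 k)
      (v l * derive1 x (z l t) 0 k).
    have := is_derive1_comp (is_derive_curve x x_class4 (z l t) k)
      (solution_is_derive t l t0).
    by rewrite mulrC.
  have fd k : is_derive t 1 (fun p => (x (z i p) - x (z j p)) 0 k) (df 0 k).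
    apply: is_derive1_ext (is_deriveB (dcoord i k) (dcoord j k)) _ _ => [p|];
      by rewrite !mxE.
  have v0 : x (z i t) - x (z j t) != 0 by rewrite subr_eq0.
  apply: is_derive_eq (is_derive_W s _ t df s0 v0 fd) _.
  rewrite (pair_variationE x _ _ _ _ _ s0 neq) /df dotBr !dotZr.
  by rewrite -mulrN opprB ![dot _ _ * v _]mulrC.
have dsum := is_derive_bigsum _ (index_enum 'I_N) xpredT _ _ t (fun i _ =>
  is_derive_bigsum _ (index_enum 'I_N) (fun j : 'I_N => (i < j)%N) _ _ t (dpair i)).
apply: is_derive1_ext (is_deriveZ (N%:R `^ (- s - 1)) dsum) _ _ => [p //|].
rewrite sum_velocity -/v /GRing.scale/= mulNr mulrN opprK mulrA.
congr (_ * _).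
have [->|N0] := posnP N.
  have e : - s - 1 < 0 by move: s1; lra.
  by rewrite invr0 mul0r powR0// lt_eqF.
rewrite -powR_inv1 ?ler0n// -powRD; last by rewrite pnatr_eq0 -lt0n N0 implybT.
by congr (_ `^ _); ring.
Qed.

End Dynamics.

Lemma ordered_gap {R : realType} (N : nat) (Z : 'I_N -> R) :
  ordered_configuration Z ->
  forall i j : 'I_N, (i < j)%N -> Z i < Z j < Z i + 1.
Proof.
case: N Z => [Z _ []//|N] Z [Zlt Zlast] i j ij; rewrite Zlt//=.
have h : Z ord_max < Z ord0 + 1 by exact: Zlast.
have mono (k l : 'I_N.+1) : (k <= l)%N -> Z k <= Z l.
  by rewrite leq_eqVlt => /predU1P[/val_inj->//|/Zlt/ltW].
apply: le_lt_trans (mono j ord_max _) (lt_le_trans h _); first exact: leq_ord.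
by rewrite lerD2r mono.
Qed.

Lemma powR_small {R : realType} (s C k : R) : 1 < s -> 0 <= C -> 0 < k ->
  exists N0 : nat, forall N : nat, (N0 < N)%N -> C * N%:R `^ (1 - s) <= k.
Proof.
move=> s1 C0 k0; pose Y := (C / k) `^ (s - 1)^-1.
have s0 : 0 < s - 1 by rewrite subr_gt0.
exists (Num.truncn Y) => N YN.
have YN' : Y <= N%:R.
  by rewrite (le_trans (ltW (truncnS_gt Y)))// ler_nat.
have N0 : 0 < N%:R :> R by rewrite ltr0n (leq_ltn_trans _ YN).
have : C / k <= N%:R `^ (s - 1).
  have -> : C / k = Y `^ (s - 1).
    rewrite -powRrM mulVf ?lt0r_neq0// powRr1// divr_ge0//; exact: ltW.
  by rewrite ge0_ler_powR ?nnegrE ?powR_ge0 ?ler0n// ltW.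
rewrite ler_pdivrMr// -(opprB s) powRN ler_pdivrMr ?powR_gt0//.
by rewrite mulrC.
Qed.

Theorem theorem2p1 (R : realType) (d : nat) (s : R) (hs : 1 < s)
    (x : R -> 'rV[R]_d) (hx4 : curve_of_class 4 x)
    (hx : arclength_closed_curve x) :
  exists C : R, 0 < C /\
    forall eps : R, 0 < eps ->
      exists N0 : nat, forall N : nat, (N0 < N)%N ->
        forall z : 'I_N -> R -> R,
          is_solution s x z ->
          ordered_configuration (fun i => z i 0) ->
          forall t : R, C / eps <= t ->
            energy s x (fun i => z i t) <= zetat s * (1 + eps).
Proof.
have z0 : 0 < zetat s by rewrite divr_gt0 ?zeta_gt0// (lt_trans ltr01).
exists (8 / zetat s); split=> [|eps eps0]; first by rewrite divr_gt0.
have l0 : 0 < zetat s * eps by rewrite mulr_gt0.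
(* With [F] the excess of the energy over [zetat s], the three errors [eta * F],
   [eta * zetat s] and [K * N ^ (1 - s)] are at most [F / 4], [F / 8], [F / 8]. *)
pose eta := Num.min (1 / 4) (eps / 8).
have eta0 : 0 < eta by rewrite lt_min !divr_gt0.
have eta4 : eta <= 1 / 4 by rewrite ge_min lexx.
have eta8 : eta <= eps / 8 by rewrite ge_min lexx orbT.
have [|K K0 coer] := coercivity x hx4 hx s hs eta eta0; first by lra.
have [N0 small] := powR_small s K (zetat s * eps / 8) hs K0 (divr_gt0 l0 (ltr0Sn _ _)).
exists N0 => -[//|n] N0n z z_sol z_ord t Ct.
have t0 : 0 < t by apply: lt_le_trans Ct; rewrite divr_gt0// divr_gt0.
have {}Ct : 8 <= zetat s * eps * t.
  by move: Ct; rewrite !ler_pdivrMr// mulrC (mulrC t) mulrA.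
rewrite mulrDr mulr1 addrC -lerBlDr.
(* The decay during [[t / 2, t]] suffices, and time 0, where the derivative is
   only one-sided, stays out of the interval. *)
apply: (quadratic_decay (fun p => energy s x (fun i => z i p) - zetat s)
  (fun p => - (n.+1%:R^-1 * \sum_(i < n.+1) velocity s x (fun j => z j p) i *
                                            velocity s x (fun j => z j p) i))
  (zetat s * eps) (t / 2) t) => //.
- lra.
- lra.
- move=> p /andP[p1 _]; have p0 : 0 < p by apply: lt_le_trans p1; lra.
  have := energy_is_derive x hx4 s hs _ z z_sol p p0.
  move=> /is_deriveB/(_ (is_derive_cst (zetat s) p 1)).
  by move=> /is_derive1_ext; apply => //; rewrite subr0.
- move=> p _; rewrite oppr_le0 mulr_ge0 ?invr_ge0 ?ler0n// sumr_ge0// => i _.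
  by rewrite -expr2 sqr_ge0.
move=> p /andP[p1 _] lf; have p0 : 0 <= p by apply: le_trans p1; lra.
have gap : forall i j : 'I_n.+1, (i < j)%N -> z i p < z j p < z i p + 1.
  move=> i j ij; apply: (solution_gap x hx s _ z z_sol) => //.
    by rewrite -val_eqE /= ltn_eqF.
  exact: ordered_gap z_ord i j ij.
have [a a1 S_ge] := coer n (fun i => z i p) gap.
rewrite lerN2; apply: le_trans (sqr_mean_le _ _ a a1).
have half_le : (energy s x (fun i => z i p) - zetat s) / 2 <=
    - (n.+1%:R^-1 * \sum_(i < n.+1) velocity s x (fun j => z j p) i * a i).
  apply: le_trans S_ge; have sm := small n.+1 N0n.
  have F0 : 0 <= energy s x (fun i => z i p) - zetat s by rewrite (le_trans (ltW l0)).
  have h1 := ler_wpM2r F0 eta4; have h2 := ler_wpM2r (ltW z0) eta8.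
  move: h1 h2 sm lf; move: (energy _ _ _) (zetat s) (K * _) => E Z k; lra.
rewrite -[leRHS]sqrrN ler_pXn2r ?nnegrE//; last first.
  by rewrite (le_trans _ half_le)// divr_ge0// (le_trans (ltW l0)).
by rewrite divr_ge0// (le_trans (ltW l0)).
Qed.
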